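(* Let $K$ be a field. Given integers $r>0$ and $d>0$, there exists a transversal polymatroid $\mathcal{P}_{\mathcal{A}}$ for which the divisor class group of its toric ring satisfies $\mathrm{Cl}(R_{\mathcal{P}_{\mathcal{A}}})\cong\mathbb{Z}^{r-1}\oplus\mathbb{Z}/d\mathbb{Z}$.
   Context: Let $[n]=\{1,\ldots,n\}$ and let $\mathbf{e}_1,\ldots,\mathbf{e}_n$ be the standard basis of $\mathbb{Z}^n$; $\mathbf{u}\le\mathbf{v}$ means $u_i\le v_i$ for all $i$. Let $\mathcal{A}=(A_1,\ldots,A_s)$ be a family of nonempty subsets of $[n]$ (repetitions allowed) with $A_1\cup\cdots\cup A_s=[n]$. The transversal polymatroid presented by $\mathcal{A}$ is the set $\mathcal{P}_{\mathcal{A}}$ of all $\mathbf{u}\in\mathbb{Z}_{\ge0}^n$ such that $\mathbf{u}\le\mathbf{e}_{i_1}+\cdots+\mathbf{e}_{i_s}$ for some $i_1\in A_1,\ldots,i_s\in A_s$ (the discrete polymatroid whose set of bases is $\{\mathbf{e}_{i_1}+\cdots+\mathbf{e}_{i_s} : i_k\in A_k\}$). A transversal polymatroid is one arising in this way for some $n$ and some $\mathcal{A}$. Its toric ring is $R_{\mathcal{P}_{\mathcal{A}}}=K[\mathbf{x}^{\mathbf{v}}t : \mathbf{v}\in\mathcal{P}_{\mathcal{A}}]\subset K[x_1,\ldots,x_n,t]$, where $\mathbf{x}^{\mathbf{v}}=\prod_i x_i^{v_i}$; it is a normal domain. *)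

(* Defs.v *)
From HB Require Import structures.
From mathcomp Require Import boolp classical_sets.
From mathcomp Require Import all_boot all_order all_algebra.
From mathcomp Require Import fraction generic_quotient.
From mathcomp Require Import mpoly.

Set Implicit Arguments.
Unset Strict Implicit.
Unset Printing Implicit Defensive.

Import GRing.Theory.
Local Open Scope ring_scope.
Local Open Scope quotient_scope.

Section DivisorClassGroup.
Variable R : idomainType.
Local Notation F := {fraction R}.
Local Notation "x %:F" := (@FracField.tofrac R x).
Implicit Types (I J L : set F) (x y c : F) (a b : R).

Definition in_base x : Prop := exists a : R, x = a%:F.

Definition fractional_ideal I : Prop :=
  [/\ I 0,
      forall x y, I x -> I y -> I (x + y),
      forall a x, I x -> I (a%:F * x)
    & exists2 b : R, b != 0 & forall x, I x -> in_base (b%:F * x)].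

(* (R : I) inside Frac R *)
Definition dual I : set F := fun x => forall y, I y -> in_base (x * y).

(* the divisorial closure R : (R : I) *)
Definition vclosure I : set F := dual (dual I).

Definition divisorial I : Prop :=
  [/\ fractional_ideal I, exists2 x, I x & x != 0 & vclosure I = I].

Definition mul_ideal I J : set F := fun x =>
  exists2 s : seq (F * F), (forall p, p \in s -> I p.1 /\ J p.2)
                         & x = \sum_(p <- s) p.1 * p.2.

Definition scale_ideal c I : set F := fun x => exists2 y, I y & x = c * y.

Lemma in_baseD x y : in_base x -> in_base y -> in_base (x + y).
Proof. by case=> a -> [b ->]; exists (a + b); rewrite rmorphD. Qed.

Lemma in_baseM x y : in_base x -> in_base y -> in_base (x * y).
Proof. by case=> a -> [b ->]; exists (a * b); rewrite rmorphM. Qed.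

Lemma in_base0 : in_base 0.
Proof. by exists 0; rewrite rmorph0. Qed.

Lemma in_base1 : in_base 1.
Proof. by exists 1; rewrite rmorph1. Qed.

Lemma sub_vclosure I x : I x -> vclosure I x.
Proof. by move=> Ix y dy; rewrite mulrC; apply: dy. Qed.

Lemma dual_anti I J : (forall x, I x -> J x) -> forall x, dual J x -> dual I x.
Proof. by move=> IJ x dx y Iy; apply/dx/IJ. Qed.

Lemma dual_vclosure I : dual (vclosure I) = dual I.
Proof.
apply: funext => x; apply: propext; split; last exact: sub_vclosure.
by apply: dual_anti => y; apply: sub_vclosure.
Qed.

Lemma dual_mulP I J x :
  dual (mul_ideal I J) x <-> forall y z, I y -> J z -> in_base (x * (y * z)).
Proof.
split=> [dx y z Iy Jz | dx _ [s sIJ ->]].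
  apply: dx; exists [:: (y, z)]; last by rewrite big_seq1.
  by move=> p; rewrite inE => /eqP ->.
rewrite mulr_sumr big_seq; elim/big_ind: _ => [||p /sIJ[]].
- exact: in_base0.
- exact: in_baseD.
- exact: dx.
Qed.

Lemma mul_idealC I J : mul_ideal I J = mul_ideal J I.
Proof.
suff sub I1 J1 x : mul_ideal I1 J1 x -> mul_ideal J1 I1 x.
  by apply: funext => x; apply: propext; split; apply: sub.
case=> s sIJ ->; exists [seq (p.2, p.1) | p <- s].
  by move=> _ /mapP[p /sIJ[? ?] ->].
by rewrite big_map; apply: eq_bigr => p _; rewrite mulrC.
Qed.

Lemma dual_mul_vclosure I J :
  dual (mul_ideal (vclosure I) J) = dual (mul_ideal I J).
Proof.
apply: funext => x; apply: propext; rewrite !dual_mulP.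
split=> dx y z Iy Jz; first by apply: dx => //; apply: sub_vclosure.
rewrite mulrCA; apply: Iy => w Iw.
by rewrite -mulrA [z * w]mulrC; apply: dx.
Qed.

Lemma vclosure_mulA I J L :
  vclosure (mul_ideal I (vclosure (mul_ideal J L))) =
  vclosure (mul_ideal (vclosure (mul_ideal I J)) L).
Proof.
rewrite /vclosure mul_idealC !dual_mul_vclosure; congr dual.
apply: funext => x; apply: propext; rewrite !dual_mulP; split=> dx y z.
- have {}dx y1 y2 y3 : I y1 -> J y2 -> L y3 -> in_base (x * (y1 * y2 * y3)).
    move=> Iy1 Jy2 Ly3; rewrite -mulrA [y1 * _]mulrC; apply: dx => //.
    exists [:: (y2, y3)]; last by rewrite big_seq1.
    by move=> p; rewrite inE => /eqP ->.
  case=> s sIJ -> Lz; rewrite mulr_suml mulr_sumr big_seq.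
  elim/big_ind: _ => [||p /sIJ[? ?]]; first exact: in_base0.
    exact: in_baseD.
  exact: dx.
- have {}dx y1 y2 y3 : I y1 -> J y2 -> L y3 -> in_base (x * (y1 * y2 * y3)).
    move=> Iy1 Jy2 Ly3; apply: dx => //.
    exists [:: (y1, y2)]; last by rewrite big_seq1.
    by move=> p; rewrite inE => /eqP ->.
  case=> s sJL -> Iz; rewrite mulr_suml mulr_sumr big_seq.
  elim/big_ind: _ => [||p /sJL[? ?]]; first exact: in_base0.
    exact: in_baseD.
  by rewrite mulrC [_ * z]mulrC mulrA mulrC; apply: dx.
Qed.

Lemma vclosureK I : vclosure (vclosure I) = vclosure I.
Proof. by rewrite /vclosure -/(vclosure I) dual_vclosure. Qed.

Lemma divisorial_vclosure I (b : R) :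
  (exists2 x, I x & x != 0) ->
  b != 0 -> (forall x, I x -> in_base (b%:F * x)) ->
  divisorial (vclosure I).
Proof.
case=> x0 Ix0 nz_x0 nz_b bI; split; last exact: vclosureK.
  split.
  - by move=> y _; rewrite mul0r; apply: in_base0.
  - by move=> x y dx dy z Iz; rewrite mulrDl; apply: in_baseD; auto.
  - move=> a x dx z Iz; rewrite -mulrA; apply: in_baseM; last exact: dx.
    by exists a.
  - by exists b => // x dx; rewrite mulrC; apply: dx.
by exists x0 => //; apply: sub_vclosure.
Qed.

Lemma divisorial_mul I J :
  divisorial I -> divisorial J -> divisorial (vclosure (mul_ideal I J)).
Proof.
move=> [[_ _ _ [a nz_a aI]] [x Ix nz_x] _] [[_ _ _ [b nz_b bJ]] [y Jy nz_y] _].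
apply: (@divisorial_vclosure _ (a * b)).
- exists (x * y); last by rewrite mulf_neq0.
  exists [:: (x, y)]; last by rewrite big_seq1.
  by move=> p; rewrite inE => /eqP ->.
- by rewrite mulf_neq0.
move=> _ [s sIJ ->]; rewrite mulr_sumr big_seq.
elim/big_ind: _ => [||p /sIJ[/aI pI /bJ pJ]]; first exact: in_base0.
  exact: in_baseD.
by rewrite rmorphM mulrACA; apply: in_baseM.
Qed.

Lemma dual_base : dual in_base = in_base.
Proof.
apply: funext => x; apply: propext; split=> [dx | ix y]; last exact: in_baseM.
by rewrite -[x]mulr1; apply/dx/in_base1.
Qed.

Lemma divisorial_base : divisorial in_base.
Proof.
have <-: vclosure in_base = in_base by rewrite /vclosure !dual_base.
apply: (@divisorial_vclosure _ 1); rewrite ?oner_eq0 //.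
  by exists 1; [apply: in_base1 | rewrite oner_eq0].
by move=> x ix; rewrite rmorph1 mul1r.
Qed.

Lemma vclosure_mul1 I : divisorial I -> vclosure (mul_ideal in_base I) = I.
Proof.
case=> [[_ _ ZI _] _ {2}<-]; congr dual.
apply: funext => x; apply: propext; rewrite dual_mulP; split=> [dx y Iy|dx _ y [a ->] Iy].
  by rewrite -[y]mul1r; apply: dx => //; apply: in_base1.
by apply/dx/ZI.
Qed.

Lemma dual_scale c I : c != 0 -> dual (scale_ideal c I) = scale_ideal c^-1 (dual I).
Proof.
move=> nz_c; apply: funext => x; apply: propext; split=> [dx | [y dy ->] _ [z Iz ->]].
  exists (c * x); last by rewrite mulKf.
  by move=> y Iy; rewrite mulrAC mulrC; apply: dx; exists y.
by rewrite mulrACA mulVf // mul1r; apply: dy.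
Qed.

Lemma vclosure_scale c I :
  c != 0 -> vclosure (scale_ideal c I) = scale_ideal c (vclosure I).
Proof. by move=> nz_c; rewrite /vclosure !dual_scale ?invr_eq0 ?invrK. Qed.

Lemma mul_scale c I J : mul_ideal (scale_ideal c I) J = scale_ideal c (mul_ideal I J).
Proof.
apply: funext => x; apply: propext; split=> [[s sIJ ->]|[_ [s sIJ ->] ->]].
  rewrite big_seq; elim/big_ind: _ => [|x1 x2 [y1 [s1 ? ->] ->] [y2 [s2 ? ->] ->]|p].
  - by exists 0; [exists [::] => //; rewrite big_nil | rewrite mulr0].
  - exists (\sum_(p <- s1 ++ s2) p.1 * p.2); last by rewrite big_cat mulrDr.
    by exists (s1 ++ s2) => // p; rewrite mem_cat => /orP[]; auto.
  - move=> /sIJ[[y Iy ->] Jp]; exists (y * p.2); last by rewrite mulrA.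
    exists [:: (y, p.2)]; last by rewrite big_seq1.
    by move=> q; rewrite inE => /eqP ->.
exists [seq (c * p.1, p.2) | p <- s].
  by move=> _ /mapP[p /sIJ[Ip Jp] ->]; split=> //; exists p.1.
by rewrite big_map mulr_sumr; apply: eq_bigr => p _; rewrite mulrA.
Qed.

Record divisorial_ideal := DivisorialIdeal {
  ideal_set :> set F;
  ideal_setP : divisorial ideal_set
}.

HB.instance Definition _ :=
  Choice.copy divisorial_ideal {classic divisorial_ideal}.

Implicit Types D E : divisorial_ideal.

Lemma divisorial_ideal_inj D E : D = E :> set F -> D = E.
Proof.
case: D E => [I dI] [J dJ] /= eqIJ; rewrite {}eqIJ in dI *.
by congr DivisorialIdeal; apply: Prop_irrelevance.
Qed.

Definition mul_div D E : divisorial_ideal :=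
  DivisorialIdeal (divisorial_mul (ideal_setP D) (ideal_setP E)).

Definition unit_div : divisorial_ideal := DivisorialIdeal divisorial_base.

Definition lin_equiv : rel divisorial_ideal := fun D E =>
  `[< exists2 c, c != 0 & (E : set F) = scale_ideal c D >].

Lemma scale_scale c c' I : scale_ideal c (scale_ideal c' I) = scale_ideal (c * c') I.
Proof.
apply: funext => x; apply: propext; split=> [[_ [y Iy ->] ->]|[y Iy ->]].
  by exists y; rewrite ?mulrA.
by exists (c' * y); [exists y | rewrite mulrA].
Qed.

Lemma scale1 I : scale_ideal 1 I = I.
Proof.
apply: funext => x; apply: propext; split=> [[y Iy ->]|Ix]; first by rewrite mul1r.
by exists x; rewrite ?mul1r.
Qed.

Lemma lin_equiv_refl : reflexive lin_equiv.
Proof. by move=> D; apply/asboolP; exists 1; rewrite ?oner_eq0 ?scale1. Qed.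

Lemma lin_equiv_sym : ssrbool.symmetric lin_equiv.
Proof.
suff sub D E : lin_equiv D E -> lin_equiv E D by move=> D E; apply/idP/idP; apply: sub.
move=> /asboolP[c nz_c EcD]; apply/asboolP; exists c^-1; rewrite ?invr_eq0 // EcD.
by rewrite scale_scale mulVf // scale1.
Qed.

Lemma lin_equiv_trans : transitive lin_equiv.
Proof.
move=> D2 D1 D3 /asboolP[c nz_c E12] /asboolP[c' nz_c' E23]; apply/asboolP.
by exists (c' * c); rewrite ?mulf_neq0 // E23 E12 scale_scale.
Qed.

Canonical lin_equiv_rel :=
  EquivRel lin_equiv lin_equiv_refl lin_equiv_sym lin_equiv_trans.

(* Divisorial fractional ideals modulo principal ones, written additively;
   the sum of two classes is that of the divisorial closure of the product.
   This is a commutative monoid for every domain, and it is a group (the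
   divisor class group) exactly when R is completely integrally closed, in
   particular when R is a Noetherian normal domain. *)
Definition Cl := {eq_quot lin_equiv}.

HB.instance Definition _ : EqQuotient _ lin_equiv Cl := EqQuotient.on Cl.
HB.instance Definition _ := Choice.on Cl.

Definition Cl_zero : Cl := \pi_Cl unit_div.
Definition Cl_add (X Y : Cl) : Cl := \pi_Cl (mul_div (repr X) (repr Y)).

Lemma mul_divC : commutative mul_div.
Proof. by move=> D E; apply: divisorial_ideal_inj; rewrite /= mul_idealC. Qed.

Lemma mul_divA : associative mul_div.
Proof. by move=> D1 D2 D3; apply: divisorial_ideal_inj; rewrite /= vclosure_mulA. Qed.

Lemma mul_1div : left_id unit_div mul_div.
Proof.
by move=> D; apply: divisorial_ideal_inj; rewrite /= vclosure_mul1 //; case: D.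
Qed.

Lemma lin_equiv_mulr D E E' : lin_equiv E E' -> lin_equiv (mul_div E D) (mul_div E' D).
Proof.
move=> /asboolP[c nz_c EE']; apply/asboolP; exists c => //=.
by rewrite EE' mul_scale vclosure_scale.
Qed.

Lemma pi_mul_div D E : \pi_Cl (mul_div D E) = Cl_add (\pi_Cl D) (\pi_Cl E).
Proof.
have equiv_repr D1 : lin_equiv D1 (repr (\pi_Cl D1)).
  by apply/(@eqquotP _ _ Cl); rewrite reprK.
apply/(@eqquotP _ _ Cl); apply: lin_equiv_trans (lin_equiv_mulr _ (equiv_repr D)) _.
by rewrite ![mul_div (repr (\pi_Cl D)) _]mul_divC lin_equiv_mulr.
Qed.

Fact Cl_addA : associative Cl_add.
Proof.
move=> X Y Z; rewrite -[X in LHS]reprK -[Z in RHS]reprK.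
by rewrite -!pi_mul_div mul_divA.
Qed.

Fact Cl_addC : commutative Cl_add.
Proof. by move=> X Y; rewrite /Cl_add mul_divC. Qed.

Fact Cl_add0 : left_id Cl_zero Cl_add.
Proof. by move=> X; rewrite -[X in LHS]reprK -pi_mul_div mul_1div reprK. Qed.

HB.instance Definition _ := GRing.isNmodule.Build Cl Cl_addA Cl_addC Cl_add0.

End DivisorClassGroup.

Section Polymatroid.
Variables n s : nat.
Implicit Types (A : 'I_s -> {set 'I_n}) (u : 'X_{1..n}).

Definition presentation A : bool :=
  [&& (0 < n)%N, [forall k, A k != set0] & \bigcup_(k < s) A k == [set: 'I_n]]%SET.

Definition transversal_polymatroid A : pred 'X_{1..n} := fun u =>
  [exists i : {ffun 'I_s -> 'I_n},
     [forall k, i k \in A k] && (u <= \sum_(k < s) U_(i k))%MM].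

End Polymatroid.

Section Subalgebra.
Variables (K : fieldType) (B : algType K).

(* membership in the K-subalgebra K[g : gen g] of B *)
Inductive subalgebra (gen : B -> Prop) : B -> Prop :=
| Subalgebra_gen g : gen g -> subalgebra gen g
| Subalgebra_const c : subalgebra gen c%:A
| Subalgebra_add x y : subalgebra gen x -> subalgebra gen y -> subalgebra gen (x + y)
| Subalgebra_mul x y : subalgebra gen x -> subalgebra gen y -> subalgebra gen (x * y).

End Subalgebra.

Section ToricRing.
Variables (K : fieldType) (n : nat) (P : pred 'X_{1..n}).

(* The variables of {mpoly K[n.+1]} are x_1, ..., x_n, followed by t. *)
Definition toric_gen (v : 'X_{1..n}) : {mpoly K[n.+1]} :=
  (\prod_(i < n) 'X_(widen_ord (leqnSn n) i) ^+ v i) * 'X_ord_max.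

Definition toric_pred : {pred {mpoly K[n.+1]}} := fun f =>
  `[< subalgebra (fun g => exists2 v, P v & g = toric_gen v) f >].

Fact toric_divring_closed : divring_closed toric_pred.
Proof.
have toricD f g : f \in toric_pred -> g \in toric_pred -> f + g \in toric_pred.
  by move=> /asboolP Sf /asboolP Sg; apply/asboolP/Subalgebra_add.
have toricM f g : f \in toric_pred -> g \in toric_pred -> f * g \in toric_pred.
  by move=> /asboolP Sf /asboolP Sg; apply/asboolP/Subalgebra_mul.
have toricC c : c%:MP \in toric_pred.
  by apply/asboolP; rewrite -[_%:MP]mulr1 mul_mpolyC; apply: Subalgebra_const.
split=> [|f g Sf Sg|f g Sf Sg]; first by rewrite -mpolyC1.
  by apply: toricD => //; rewrite -mulN1r -mpolyC1 -mpolyCN; apply: toricM.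
apply: toricM => //; rewrite /GRing.inv /= /mpoly_inv.
by case: ifP => // _; apply: toricC.
Qed.

HB.instance Definition _ :=
  GRing.isDivringClosed.Build {mpoly K[n.+1]} toric_pred toric_divring_closed.

Record toric_ring := ToricRing {
  toric_val : {mpoly K[n.+1]};
  _ : toric_val \in toric_pred
}.

HB.instance Definition _ := [isSub for toric_val].
HB.instance Definition _ := [Choice of toric_ring by <:].
HB.instance Definition _ := [SubChoice_isSubIntegralDomain of toric_ring by <:].

End ToricRing.

(* Main.v *)
Require Import Defs.
From HB Require Import structures.
From mathcomp Require Import boolp classical_sets.
From mathcomp Require Import all_boot all_order all_algebra.
From mathcomp Require Import fraction generic_quotient zify.
From mathcomp Require Import mpoly.

(** The polymatroid is the box [[0, d]^r], presented by [d] copies of each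
    singleton of [[r]].  The lattice points of the cone over the box are the
    exponents of the monomials [x^u t^q] with [0 <= u_i <= d q], and every one of
    them is a sum of points of the box, so the toric ring [R] is spanned by these
    monomials ([toric_predP]).  Its torus-invariant prime divisors are the [r]
    coordinate facets [u_i = 0] and the [r] facets [u_i = d q].  The divisor of
    [x_i] is the difference of the [i]-th coordinate facet and the [i]-th other
    facet, so the latter facets generate the class group, and the divisor of [t],
    which is [d] times their sum, gives the only remaining relation.  Hence
    [Cl R] is [Z^r / Z (d, ..., d)], which is [Z^(r-1) + Z/d].

    To make this explicit, [d q - u_i] is called a slack, and to [a] in [Z^r] is
    attached the fractional ideal [slack_ideal a] of the Laurent polynomials in
    [t] whose monomials have slacks at least [a].  Duality negates [a]
    ([dual_slack_ideal]), so these ideals are divisorial, and the closure of a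
    product corresponds to the sum of the parameters
    ([vclosure_slack_ideal_mul]).  Two of them are proportional exactly when the
    parameters differ by a multiple of [(d, ..., d)] ([scale_slack_ideal],
    [scale_slack_ideal_inj]).

    The remaining point is that every divisorial ideal is proportional to one of
    these ([divisorial_slack]).  It rests on two facts about the polynomial ring
    [K[x, t]], which has the same fractions as [R].  The ring has unique
    factorization ([mpoly_ufd]), so any family of polynomials has a gcd
    ([mpoly_gcd_family]), and dividing an ideal by the gcd of its elements removes
    all contributions of primes other than the slack facets.  The order of
    vanishing along a slack facet, the least slack of a monomial, is additive on
    products ([weight_msuppM]), so the conditions that remain are inequalities on
    the slacks. *)

Set Implicit Arguments.
Unset Strict Implicit.
Unset Printing Implicit Defensive.

Import Order.TTheory GRing.Theory Num.Theory.
Local Open Scope ring_scope.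
Local Open Scope quotient_scope.

(** * Unique factorization *)

Section Divisibility.
Variable A : idomainType.
Implicit Types a b c p u x : A.

Definition dvdr a b : Prop := exists c, b = a * c.

Definition prime_elt p : Prop :=
  [/\ p != 0, p \isn't a GRing.unit
    & forall a b, dvdr p (a * b) -> dvdr p a \/ dvdr p b].

Definition irreducible_elt p : Prop :=
  p \isn't a GRing.unit /\
  forall a b, p = a * b -> a \is a GRing.unit \/ b \is a GRing.unit.

(** Factorizations are an inductive predicate rather than a list of primes with
    a product, so that cancelling one prime at a time is an induction. *)
Inductive prime_product : A -> Prop :=
| Prime_product_unit u : u \is a GRing.unit -> prime_product u
| Prime_product_mul p a :
    prime_elt p -> prime_product a -> prime_product (p * a).

Definition is_ufd : Prop := forall a, a != 0 -> prime_product a.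

Lemma dvdr_mulr a b c : dvdr a b -> dvdr a (b * c).
Proof. by case=> e ->; exists (e * c); rewrite mulrA. Qed.

Lemma dvdr_mull a b c : dvdr a b -> dvdr a (c * b).
Proof. by rewrite mulrC; apply: dvdr_mulr. Qed.

Lemma dvdrD a b c : dvdr a b -> dvdr a c -> dvdr a (b + c).
Proof. by case=> e -> [f ->]; exists (e + f); rewrite mulrDr. Qed.

Lemma dvdrr a : dvdr a a.
Proof. by exists 1; rewrite mulr1. Qed.

Lemma dvdr0 a : dvdr a 0.
Proof. by exists 0; rewrite mulr0. Qed.

Lemma dvdr_trans b a c : dvdr a b -> dvdr b c -> dvdr a c.
Proof. by case=> e -> [f ->]; exists (e * f); rewrite mulrA. Qed.

Lemma dvdr_mul2l c a b : c != 0 -> dvdr (c * a) (c * b) -> dvdr a b.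
Proof. by move=> nz_c [e]; rewrite -mulrA => /(mulfI nz_c) ->; exists e. Qed.

Lemma dvdr_sum a (I : Type) (s : seq I) (P : pred I) (F : I -> A) :
  (forall i, P i -> dvdr a (F i)) -> dvdr a (\sum_(i <- s | P i) F i).
Proof. by move=> aF; elim/big_ind: _ => //; [apply: dvdr0 | apply: dvdrD]. Qed.

Lemma prime_product_neq0 a : prime_product a -> a != 0.
Proof.
elim=> [u Uu|p b [nz_p _ _] _ nz_b]; last exact: mulf_neq0.
by apply: contraTneq Uu => ->; rewrite unitr0.
Qed.

Lemma prime_productM a b :
  prime_product a -> prime_product b -> prime_product (a * b).
Proof.
move=> ppa ppb; elim: ppa => [u Uu|p c prp _ IH]; last first.
  by rewrite -mulrA; apply: Prime_product_mul.
elim: ppb => [v Uv|p c prp _ IH]; last by rewrite mulrCA; apply: Prime_product_mul.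
by apply: Prime_product_unit; rewrite unitrM Uu.
Qed.

Lemma prime_product_prime p : prime_elt p -> prime_product p.
Proof.
by rewrite -[p in prime_product p]mulr1 => /Prime_product_mul; apply;
  apply/Prime_product_unit/unitr1.
Qed.

End Divisibility.

(** Unique factorization passes from [A] to [A[X]].  The argument never mentions
    the field of fractions of [A]: pseudo-division replaces division, and the
    constants it introduces are cancelled one prime at a time. *)
Section PolynomialUFD.
Variable A : idomainType.
Hypothesis ufdA : is_ufd A.
Implicit Types (a c p : A) (f g h : {poly A}).

Lemma dvdr_polyCP c f : dvdr c%:P f <-> forall i, dvdr c f`_i.
Proof.
split=> [[g ->] i|cf]; first by rewrite coefCM; exists g`_i.
have [e fe] := choice cf.
exists (\poly_(i < size f) e i); apply/polyP=> i.
rewrite coefCM coef_poly; case: ltnP => [_|le_fi]; first exact: fe.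
by rewrite mulr0 nth_default.
Qed.

(** If [p] divides neither [f] nor [g], take the first coefficients of [f] and [g]
    that it does not divide: modulo [p] their product is a coefficient of
    [f * g]. *)
Lemma prime_polyC p : prime_elt p -> prime_elt p%:P.
Proof.
case=> nz_p nUp prp; split=> [||f g].
- by rewrite polyC_eq0.
- by rewrite poly_unitE coefC negb_and nUp orbT.
move=> dfg.
have [df|/dvdr_polyCP/existsNP[i0 ndf]] := pselect (dvdr p%:P f); first by left.
have [dg|/dvdr_polyCP/existsNP[j0 ndg]] := pselect (dvdr p%:P g); first by right.
have exf : exists i, `[< ~ dvdr p f`_i >] by exists i0; apply/asboolP.
have exg : exists i, `[< ~ dvdr p g`_i >] by exists j0; apply/asboolP.
case: (ex_minnP exf) => i /asboolP ndi mini.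
case: (ex_minnP exg) => j /asboolP ndj minj.
have lt_i_dvd k : (k < i)%N -> dvdr p f`_k.
  move=> lt_ki; apply: contrapT => /asboolP/mini.
  by rewrite leqNgt lt_ki.
have lt_j_dvd k : (k < j)%N -> dvdr p g`_k.
  move=> lt_kj; apply: contrapT => /asboolP/minj.
  by rewrite leqNgt lt_kj.
exfalso; have/dvdr_polyCP/(_ (i + j)%N) := dfg.
rewrite coefM (bigD1 (inord i)) //=.
rewrite inordK ?ltnS ?leq_addr // addKn => dsum.
have: dvdr p (f`_i * g`_j).
  set S := \sum_(_ < _ | _) _ in dsum.
  rewrite -[_ * _](addrK S); apply: dvdrD => //.
  rewrite -mulN1r; apply: dvdr_mull; apply: dvdr_sum => k ne_ki.
  have [lt_ki|le_ik] := ltnP k i; first exact/dvdr_mulr/lt_i_dvd.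
  apply/dvdr_mull/lt_j_dvd.
  have lt_ik : (i < k)%N.
    rewrite ltn_neqAle le_ik andbT; apply: contraNneq ne_ki => ik.
    by apply/eqP/val_inj; rewrite /= inordK // ?ltnS ?leq_addr.
  by rewrite ltn_subLR ?ltn_add2r // -ltnS.
by case/prp.
Qed.

Lemma prime_product_polyC c : prime_product c -> prime_product c%:P.
Proof.
elim=> [u Uu|p a prp _ IH]; first exact/Prime_product_unit/rmorph_unit.
by rewrite polyCM; apply: Prime_product_mul IH; apply: prime_polyC.
Qed.

(** A prime constant dividing [f * k] divides [k], since it cannot divide an
    irreducible polynomial of positive degree. *)
Lemma irreducible_polyC_cancel f c h :
  irreducible_elt f -> (1 < size f)%N -> prime_product c ->
  dvdr f (c%:P * h) -> dvdr f h.
Proof.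
move=> [nUf irf] gt1f; elim=> [u Uu|p a prp _ IH] [k].
  move=> uh; exists (u^-1%:P * k).
  by rewrite mulrCA -uh mulrA -polyCM mulVr ?mul1r.
rewrite polyCM -mulrA => pah; apply: IH.
have [nz_p nUp /(_ f k)[|[g fE]|[k' kE]]] := prime_polyC prp.
- by exists (a%:P * h).
- have [Up|Ug] := irf _ _ fE; first by rewrite Up in nUp.
  move: gt1f; rewrite fE (size_Cmul _ (_ : p != 0)); last by case: prp.
  by rewrite ltnNge; move: Ug; rewrite poly_unitE => /andP[/eqP->].
- by exists k'; apply: (mulfI nz_p); rewrite pah kE mulrCA.
Qed.

(** Each prime factor of [c] divides [q] or [w], and is removed from the factor
    that it divides. *)
Lemma prime_product_split c f q w :
  prime_product c -> c%:P * f = q * w ->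
  exists q' w' c1, [/\ f = q' * w', w = c1%:P * w' & c1 != 0].
Proof.
move=> ppc; elim: ppc q w => [u Uu|p a prp _ IH] q w.
  move=> uf; exists (u^-1%:P * q), w, 1; rewrite mul1r oner_eq0.
  by split=> //; rewrite -mulrA -uf mulrA -polyCM mulVr ?mul1r.
rewrite polyCM -mulrA => paf.
have [nz_p nUp /(_ q w)[|[q1 qE]|[w1 wE]]] := prime_polyC prp.
- by exists (a%:P * f).
- by apply: (IH q1 w); apply: (mulfI nz_p); rewrite paf qE mulrA.
have [|q' [w' [c1 [fE w1E nz_c1]]]] := IH q w1.
  by apply: (mulfI nz_p); rewrite paf wE mulrCA.
exists q', w', (p * c1); split=> //; first by rewrite wE w1E polyCM mulrA.
by rewrite mulf_neq0 //; case: prp.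
Qed.

(** Let [f] divide [g * h] but not [h], and let [w] be of least degree among the
    polynomials [u] such that [f] divides [u * h].  These form an ideal containing
    [f] and [g], so that up to a constant factor [w] divides both; as [f] is
    irreducible, [w] is [f] up to a constant, and [f] divides [g] after cancelling
    constants. *)
Lemma irreducible_poly_prime f :
  irreducible_elt f -> (1 < size f)%N -> prime_elt f.
Proof.
move=> irf gt1f; have [nUf irrf] := irf.
have nz_f : f != 0 by rewrite -size_poly_gt0 (ltn_trans _ gt1f).
split=> // g h dgh.
have [dh|ndh] := pselect (dvdr f h); [by right | left].
pose J u := dvdr f (u * h).
have exw : exists m, `[< exists w, [/\ w != 0, J w & size w = m] >].
  by exists (size f); apply/asboolP; exists f; split=> //; apply/dvdr_mulr/dvdrr.
case: (ex_minnP exw) => _ /asboolP[w [nz_w Jw <-]] minw.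
(* the remainder of the pseudo-division by w is again in the ideal *)
have Jdiv u : J u -> exists c q, c != 0 /\ c%:P * u = q * w.
  move=> Ju; exists (lead_coef w ^+ scalp u w), (u %/ w).
  have equ := Pdiv.Idomain.divp_eq u w.
  rewrite mul_polyC expf_neq0 ?lead_coef_eq0 //; split=> //.
  rewrite equ; apply/eqP; rewrite -subr_eq0 addrC addKr; apply/negPn/negP => nz_r.
  have: (size (modp u w) < size w)%N by rewrite ltn_modp.
  apply/negP; rewrite -leqNgt; apply: minw; apply/asboolP.
  exists (u %% w); split=> //; rewrite /J.
  have ->: u %% w = lead_coef w ^+ scalp u w *: u - (u %/ w) * w.
    by rewrite equ addrC addKr.
  rewrite mulrBl; apply: dvdrD; first by rewrite -scalerAl -mul_polyC; apply: dvdr_mull.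
  by rewrite -mulrA -mulNr; apply: dvdr_mull.
have gt1w : (1 < size w)%N.
  rewrite ltnNge; apply/negP => /size1_polyC wE; apply: ndh.
  have nz_w0 : w`_0 != 0 by rewrite -polyC_eq0 -wE.
  by apply: (irreducible_polyC_cancel irf gt1f (ufdA nz_w0)); rewrite -wE.
have [|c [q [nz_c fq]]] := Jdiv f; first exact/dvdr_mulr/dvdrr.
have [q' [w' [c1 [fE wE nz_c1]]]] := prime_product_split (ufdA nz_c) fq.
have [Uq|Uw] := irrf _ _ fE; last first.
  move: gt1w; rewrite wE size_Cmul // ltnNge.
  by move: Uw; rewrite poly_unitE => /andP[/eqP->].
have [e [q2 [nz_e gq]]] := Jdiv g dgh.
apply: (irreducible_polyC_cancel irf gt1f (ufdA nz_e)).
exists (q2 * c1%:P * q'^-1); rewrite gq wE fE -[LHS]mulr1 -(mulrV Uq).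
by rewrite [q2 * (_ * _)]mulrA [RHS]mulrC [q' * w']mulrC [RHS]mulrACA [q'^-1 * _]mulrC.
Qed.

(** The leading coefficient of [f] is a possible [c].  An induction on the factors
    of [c] needs the hypothesis in the present form: a prime factor of [c] that
    does not divide [f] can be dropped from [c] without changing [f]. *)
Lemma primitive_part c f :
  prime_product c -> (forall e, dvdr e%:P f -> dvdr e c) ->
  exists c1 f1, [/\ f = c1%:P * f1, prime_product c1
                  & forall e, dvdr e%:P f1 -> e \is a GRing.unit].
Proof.
move=> ppc; elim: ppc f => [u Uu|p a prp _ IH] f fc.
  exists 1, f; rewrite mul1r; split=> // [|e /fc[k uE]].
    exact/Prime_product_unit/unitr1.
  by move: Uu; rewrite uE unitrM => /andP[].
have [nz_p _ pP] := prp.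
have [[f1 fE]|ndf] := pselect (dvdr p%:P f).
  have [e df1|c1 [f2 [f1E ppc1 prf2]]] := IH f1.
    apply: (@dvdr_mul2l _ p) => //; apply: fc; rewrite fE polyCM.
    by case: df1 => k ->; exists k; rewrite mulrA.
  exists (p * c1), f2; split=> //; first by rewrite fE f1E polyCM mulrA.
  exact: Prime_product_mul.
apply: IH => e de; have [k pa] := fc e de.
have [||[k' kE]] := pP e k; first by exists a.
  case=> e' eE; case: ndf; apply: dvdr_trans de.
  by exists e'%:P; rewrite eE polyCM.
by exists k'; apply: (mulfI nz_p); rewrite pa kE mulrCA.
Qed.

Lemma poly_ufd : is_ufd {poly A}.
Proof.
move=> f; move: {-1}(size f) (leqnn (size f)) => n.
elim: n f => [|n IH] f; first by rewrite leqn0 size_poly_eq0 => ->.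
move=> lefn nz_f.
have [|e /dvdr_polyCP/(_ _)/= df|c1 [f1 [fE ppc1 prf1]]] :=
  @primitive_part (lead_coef f) f; first by apply: ufdA; rewrite lead_coef_eq0.
  exact: df.
rewrite fE; apply: prime_productM; first exact: prime_product_polyC.
have nz_c1 := prime_product_neq0 ppc1.
have nz_f1 : f1 != 0 by apply: contraNneq nz_f; rewrite fE => ->; rewrite mulr0.
have {}lefn : (size f1 <= n.+1)%N by rewrite fE size_Cmul in lefn.
have [le_f1|gt1f] := leqP (size f1) 1.
  have f1E := size1_polyC le_f1; rewrite f1E; apply/Prime_product_unit/rmorph_unit.
  by apply: prf1; rewrite -f1E; apply: dvdrr.
have nUf : f1 \isn't a GRing.unit by rewrite poly_unitE (gtn_eqF gt1f).
have [irf|nirf] := pselect (irreducible_elt f1).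
  exact/prime_product_prime/irreducible_poly_prime.
have [a [b [f1E nUa nUb]]] :
    exists a b : {poly A}, [/\ f1 = a * b, a \isn't a GRing.unit & b \isn't a GRing.unit].
  apply: contrapT => nab; apply: nirf; split=> // a b f1E.
  have [|/negP nUa] := boolP (a \is a GRing.unit); [by left | right].
  by apply/negPn/negP => nUb; apply: nab; exists a, b; split=> //; apply/negP.
have gt1 (g : {poly A}) : dvdr g f1 -> g \isn't a GRing.unit -> (1 < size g)%N.
  move=> dg; apply: contraNltn => /size1_polyC gE.
  by rewrite gE; apply/rmorph_unit/prf1; rewrite -gE.
have gt1a : (1 < size a)%N by apply: gt1 => //; rewrite f1E; apply/dvdr_mulr/dvdrr.
have gt1b : (1 < size b)%N by apply: gt1 => //; rewrite f1E; apply/dvdr_mull/dvdrr.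
have /andP[nz_a nz_b] : (a != 0) && (b != 0) by rewrite -negb_or -mulf_eq0 -f1E.
move: lefn; rewrite f1E size_mul // => le_ab.
by apply: prime_productM; apply: IH => //; lia.
Qed.
End PolynomialUFD.

(** * Unique factorization and gcds of multivariate polynomials *)

Lemma ufd_iso (A B : idomainType) (f : {rmorphism A -> B}) :
  bijective f -> is_ufd B -> is_ufd A.
Proof.
move=> [g fK gK] ufdB a nz_a; rewrite -[a]fK.
have gM : {morph g : x y / x * y} by move=> x y; rewrite -[x]gK -[y]gK -rmorphM !fK.
have g_unit u : u \is a GRing.unit -> g u \is a GRing.unit.
  move=> Uu; apply/unitrP; exists (g u^-1); split; rewrite -gM ?mulVr ?mulrV //;
  by apply: (can_inj fK); rewrite gK rmorph1.
have: prime_product (f a).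
  by apply: ufdB; rewrite -(rmorph0 f) (inj_eq (can_inj fK)).
elim: {nz_a}(f a) / => [u /g_unit/Prime_product_unit//|p b [nz_p nUp prp] _ IH].
rewrite gM; apply: Prime_product_mul IH; split=> [||x y].
- by rewrite -(inj_eq (can_inj fK)) gK rmorph0.
- by apply: contra nUp => /(rmorph_unit f); rewrite gK.
have dvd_g z : dvdr p (f z) <-> dvdr (g p) z.
  split=> [[c fzE]|[c ->]]; first by exists (g c); rewrite -gM -fzE fK.
  by rewrite rmorphM gK; exists (f c).
by rewrite -!dvd_g rmorphM; apply: prp.
Qed.

Section MultivariateUFD.
Variable K : fieldType.

Lemma muniX n (m : 'X_{1..n.+1}) :
  muni ('X_[m] : {mpoly K[n.+1]}) =
  'X_[[multinom m (widen_ord (leqnSn n) i) | i < n]] *: 'X^(m ord_max).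
Proof. by rewrite muniE msuppX big_seq1 mcoeffX eqxx scale1r. Qed.

Lemma ord_max_or_widen n (i : 'I_n.+1) :
  i = ord_max \/ exists j : 'I_n, i = widen_ord (leqnSn n) j.
Proof.
have [lt_in|le_ni] := ltnP i n; [right | left].
  by exists (Ordinal lt_in); apply: val_inj.
by apply/val_inj/eqP; rewrite eqn_leq le_ni -ltnS ltn_ord.
Qed.

Definition mnm_rcons n (m : 'X_{1..n}) (k : nat) : 'X_{1..n.+1} :=
  [multinom of rcons m k].

Lemma mnm_rcons_max n (m : 'X_{1..n}) k : mnm_rcons m k ord_max = k.
Proof. by rewrite (mnm_nth 0%N) /= nth_rcons size_tuple ltnn eqxx. Qed.

Lemma mnm_rcons_widen n (m : 'X_{1..n}) k (i : 'I_n) :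
  mnm_rcons m k (widen_ord (leqnSn n) i) = m i.
Proof. by rewrite !(mnm_nth 0%N) /= nth_rcons size_tuple ltn_ord. Qed.

Lemma mnm_rconsE n (m : 'X_{1..n.+1}) :
  m = mnm_rcons [multinom m (widen_ord (leqnSn n) i) | i < n] (m ord_max).
Proof.
apply/mnmP=> i; have [->|[j ->]] := ord_max_or_widen i.
  by rewrite mnm_rcons_max.
by rewrite mnm_rcons_widen mnmE.
Qed.

Lemma coef_muni n (p : {mpoly K[n.+1]}) (k : nat) (m : 'X_{1..n}) :
  (muni p)`_k@_m = p@_(mnm_rcons m k).
Proof.
rewrite [in LHS](mpolyE p) [in RHS](mpolyE p) !raddf_sum coef_sum raddf_sum /=.
apply: eq_bigr => m' _; rewrite muniZ muniX !coefZ coefXn mcoeffZ mcoeffX.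
rewrite mcoeffCM; congr (_ * _).
set m1 := [multinom _ | _ < _].
have -> : (m' == mnm_rcons m k) = (m1 == m) && (m' ord_max == k).
  apply/eqP/andP => [m'E|[/eqP <- /eqP <-]]; last exact: mnm_rconsE.
  rewrite m'E mnm_rcons_max; split=> //; apply/eqP/mnmP=> i.
  by rewrite mnmE m'E mnm_rcons_widen.
rewrite (eq_sym k); case: eqP => _; rewrite ?andbT ?andbF /=.
  by rewrite mulr1 mcoeffX.
by rewrite mulr0 mcoeff0.
Qed.

Lemma muni_mwiden n (c : {mpoly K[n]}) : muni (mwiden c) = c%:P.
Proof.
rewrite [in LHS](mpolyE c) [in RHS](mpolyE c) (raddf_sum (@mwiden n K)) !raddf_sum /=.
apply: eq_bigr => m _.
rewrite mwidenZ mwidenX muniZ muniX mnmwiden_ordmax expr0.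
rewrite -!mul_polyC mulr1 -polyCM mul_mpolyC; congr (_ *: 'X_[_])%:P.
by apply/mnmP=> i; rewrite mnmE mnmwiden_widen.
Qed.

Lemma muni_bij n : bijective (@muni n K).
Proof.
suff muniK : cancel (@mmulti n K) (@muni n K).
  exists (@mmulti n K) => // p; apply/mpolyP=> m.
  by rewrite (mnm_rconsE m) -!coef_muni muniK.
move=> q; rewrite /mmulti raddf_sum -[RHS]coefK poly_def; apply: eq_bigr => i _.
rewrite /= muniM muni_mwiden rmorphXn /= muniX mul_polyC; congr (_ *: _ ^+ i).
rewrite mnm1E eqxx expr1 -[RHS]scale1r -mpolyX0; congr ('X_[_] *: _).
apply/mnmP=> j; rewrite mnmE mnm1E mnm0E; case: eqP => // /(congr1 val)/= jn.
by have := ltn_ord j; rewrite -jn ltnn.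
Qed.

Lemma mpoly_ufd n : is_ufd {mpoly K[n]}.
Proof.
elim: n => [|n IH]; last exact/(ufd_iso (muni_bij n))/poly_ufd.
move=> p nz_p; apply: Prime_product_unit.
have pE : p = (p@_0)%:MP.
  apply/mpolyP=> m; rewrite mcoeffC.
  suff -> : m = 0%MM by rewrite eqxx mulr1.
  by apply/mnmP; case.
rewrite pE; apply: rmorph_unit; rewrite unitfE; apply: contraNneq nz_p => p0.
by rewrite pE p0 mpolyC0.
Qed.

End MultivariateUFD.

Section Gcd.
Variables (K : fieldType) (n : nat).
Implicit Types (g h p q : {mpoly K[n]}) (I : {mpoly K[n]} -> Prop).

Lemma msize_prime p : prime_elt p -> (1 < msize p)%N.
Proof.
case=> nz_p nUp _; rewrite ltnNge; apply: contra nUp => /msize1_polyC pE.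
rewrite pE; apply: rmorph_unit; rewrite unitfE; apply: contraNneq nz_p => p0.
by rewrite pE p0 mpolyC0.
Qed.

(** The conclusion says that [h] generates the divisorial closure of the ideal
    spanned by [I].  A common divisor of largest size works: the quotients of [I]
    by [h] have no common prime factor, so each prime factor of [q] can be
    cancelled against [p]. *)
Lemma mpoly_gcd_family I :
  (exists2 g, I g & g != 0) ->
  exists h, [/\ h != 0, forall g, I g -> dvdr h g
    & forall p q, (forall g, I g -> dvdr q (p * g)) -> dvdr q (p * h)].
Proof.
case=> g0 Ig0 nz_g0.
pose cd h := forall g, I g -> dvdr h g.
have cd_neq0 h : cd h -> h != 0.
  by move=> /(_ _ Ig0)[k g0E]; apply: contraNneq nz_g0 => h0; rewrite g0E h0 mul0r.
have exh : exists m, `[< exists2 h, cd h & msize h = m >].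
  exists (msize (1 : {mpoly K[n]})); apply/asboolP.
  by exists 1 => // g _; exists g; rewrite mul1r.
have bound m : `[< exists2 h, cd h & msize h = m >] -> (m <= msize g0)%N.
  move=> /asboolP[h cdh <-]; have nz_h := cd_neq0 h cdh.
  have [k g0E] := cdh _ Ig0; have nz_k : k != 0.
    by apply: contraNneq nz_g0 => k0; rewrite g0E k0 mulr0.
  by rewrite g0E msizeM // (mpolySpred _ nz_k) addnS leq_addr.
case: (ex_maxnP exh bound) => _ /asboolP[h cdh <-] maxh.
have nz_h := cd_neq0 h cdh; exists h; split=> // p q qpI.
have [q0|nz_q] := eqVneq q 0.
  have [k /eqP] := qpI _ Ig0; rewrite q0 mul0r mulf_eq0 (negbTE nz_g0) orbF => /eqP->.
  by rewrite mul0r; apply: dvdr0.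
have {}qpI k g : I g -> g = h * k -> dvdr q (p * h * k).
  by move=> Ig gE; rewrite -mulrA -gE; apply: qpI.
elim: (mpoly_ufd nz_q) {p}(p * h) qpI => {q nz_q} [u Uu|x q prx _ IH] p qpI.
  by exists (u^-1 * p); rewrite mulrA mulrV ?mul1r.
have [nz_x _ xP] := prx.
have [k [g [Ig gE ndk]]] : exists k g, [/\ I g, g = h * k & ~ dvdr x k].
  apply: contrapT => nex.
  have/asboolP/maxh : exists2 h', cd h' & msize h' = msize (h * x).
    exists (h * x) => // g Ig; have [k gE] := cdh g Ig.
    have [[k' kE]|ndk] := pselect (dvdr x k); first by exists k'; rewrite gE kE mulrA.
    by case: nex; exists k, g.
  rewrite msizeM //; case: (msize x) (msize_prime prx) => [|[|j]] // _.
  by rewrite !addnS /= ltnNge leq_addr.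
have [|[p' pE]|//] := xP p k.
  by have [e ->] := qpI _ _ Ig gE; exists (q * e); rewrite mulrA.
rewrite pE; have [|e ->] := IH p'; last by exists e; rewrite mulrA.
move=> k' g' Ig' g'E; apply: (dvdr_mul2l nz_x).
by rewrite mulrA -pE; apply: qpI g'E.
Qed.

End Gcd.

(** * The order of vanishing along a facet is a valuation *)

Lemma seq_has_minimum (T : eqType) (le : rel T) (s : seq T) x0 :
  total le -> transitive le -> x0 \in s ->
  exists2 x, x \in s & {in s, forall y, le x y}.
Proof.
move=> le_total le_trans s_x0; have sorted_s := sort_sorted le_total s.
case sE: (sort le s) => [|x s'].
  by rewrite -(mem_sort le) sE in s_x0.
exists x; first by rewrite -(mem_sort le) sE mem_head.
move=> y; rewrite -(mem_sort le) sE inE => /predU1P[->|s'y].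
  by have := le_total x x; rewrite orbb.
move: sorted_s; rewrite sE /= path_sortedE // => /andP[/allP/(_ y s'y)]//.
Qed.

Section Weight.
Variables (R : idomainType) (n : nat) (l : 'X_{1..n} -> int).
Hypothesis lD : forall m1 m2, l (m1 + m2)%MM = l m1 + l m2.
Implicit Types (p q : {mpoly R[n]}) (m : 'X_{1..n}).

(** The least weight of a monomial is additive on products.  Among the monomials
    of least weight in [p] and [q], pick the smallest ones for the monomial order:
    no other pair of monomials contributes to the coefficient of their product. *)
Lemma weight_msuppM p q (c : int) :
  (forall m, m \in msupp (p * q) -> c <= l m) ->
  forall m1 m2, m1 \in msupp p -> m2 \in msupp q -> c <= l m1 + l m2.
Proof.
move=> pq_ge m1 m2 p_m1 q_m2.
pose le m m' := (l m < l m') || ((l m == l m') && (m <= m')%O).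
have total_le : total le.
  by move=> m m'; rewrite /le; case: ltgtP => //= _; apply: le_total.
have trans_le : transitive le.
  move=> m' m m''; rewrite /le => /orP[lt1|/andP[/eqP-> le1]] /orP[lt2|/andP[/eqP e2 le2]].
  - by rewrite (lt_trans lt1).
  - by rewrite -e2 lt1.
  - by rewrite lt2.
  - by rewrite e2 eqxx (le_trans le1) ?orbT.
have [a p_a min_a] := seq_has_minimum total_le trans_le p_m1.
have [b q_b min_b] := seq_has_minimum total_le trans_le q_m2.
have le_l m m' : le m m' -> l m <= l m'.
  by case/orP => [/ltW//|/andP[/eqP->]].
have le_ab : l a + l b <= l m1 + l m2.
  by apply: lerD; apply: le_l; [apply: min_a | apply: min_b].
apply: le_trans le_ab.
rewrite -lD; apply: pq_ge; rewrite mcoeff_msupp.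
suff -> : (p * q)@_(a + b) = p@_a * q@_b by rewrite mulf_neq0 // -mcoeff_msupp.
rewrite mpolyME raddf_sum /= (bigD1_seq (a, b)) /=; last 2 first.
- exact: allpairs_f.
- by apply: allpairs_uniq => // -[? ?] [? ?] _ _ [-> ->].
rewrite mcoeffZ mcoeffX eqxx mulr1 big1_seq ?addr0 // => -[a' b'] /=.
case/andP=> ne_ab /allpairsP[[a1 b1] /= [p_a1 q_b1 [ea eb]]].
rewrite -{a1}ea -{b1}eb in p_a1 q_b1.
rewrite mcoeffZ mcoeffX; case: eqP => [eqD|]; rewrite ?mulr0 //.
case/negP: ne_ab.
have lea := min_a _ p_a1; have leb := min_b _ q_b1.
have lab : l a' + l b' = l a + l b by rewrite -!lD eqD.
have := le_l _ _ lea; have := le_l _ _ leb => l_b l_a.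
have [la lb] : l a' = l a /\ l b' = l b by split; lia.
move: lea leb; rewrite /le la lb !eqxx !ltxx /= => lea leb.
have [eqa|nea] := eqVneq a a'.
  by rewrite -eqa; move: eqD; rewrite -eqa => /addmI ->.
have lta : (a < a')%O by rewrite lt_neqAle nea.
by have := ltmc_le_add lta leb; rewrite eqD ltxx.
Qed.
End Weight.

(** * The box polymatroid and its toric ring *)

Section Box.
Variables r d : nat.
Implicit Types (v : 'X_{1..r}) (m : 'X_{1..r.+1}).

Definition box_family (k : 'I_#|{: 'I_r * 'I_d}|) : {set 'I_r} :=
  [set (enum_val k).1]%SET.

Lemma box_presentation : (0 < r)%N -> (0 < d)%N -> presentation box_family.
Proof.
move=> r_gt0 d_gt0; rewrite /presentation r_gt0 /=; apply/andP; split.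
  by apply/forallP=> k; apply/set0Pn; exists (enum_val k).1; rewrite set11.
apply/eqP/setP=> i; rewrite in_setT; apply/bigcupP.
exists (enum_rank (i, Ordinal d_gt0)) => //.
by rewrite /box_family enum_rankK set11.
Qed.

Lemma box_polymatroid v :
  transversal_polymatroid box_family v = [forall i, (v i <= d)%N].
Proof.
pose c : {ffun 'I_#|{: 'I_r * 'I_d}| -> 'I_r} := [ffun k => (enum_val k).1].
have sum_c i : ((\sum_k U_(c k))%MM : 'X_{1..r}) i = d.
  rewrite mnm_sumE; under eq_bigr => k _ do rewrite mnm1E ffunE.
  rewrite -(@big_enum_val _ _ _ _ {: 'I_r * 'I_d} (fun x => (x.1 == i : nat))).
  rewrite -(pair_big predT predT (fun a (_ : 'I_d) => (a == i : nat))) /=.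
  rewrite (bigD1 i) //= eqxx sum1_card card_ord big1 ?addn0 // => j /negPf->.
  by rewrite big1.
apply/existsP/forallP => [[f /andP[/forallP fA /mnm_lepP le_v]] i|le_v].
  rewrite -(sum_c i); suff -> : c = f by apply: le_v.
  by apply/ffunP=> k; have /set1P-> := fA k; rewrite ffunE.
exists c; apply/andP; split; first by apply/forallP=> k; rewrite ffunE set11.
by apply/mnm_lepP=> i; rewrite sum_c.
Qed.

(** In terms of a monomial [x^u t^q] this is [d q - u_i]; the facets of the cone
    over the box are the [r] hyperplanes where a slack vanishes and the [r]
    coordinate hyperplanes [u_i = 0], and membership in [{mpoly R[r.+1]}] already
    accounts for the latter. *)
Definition slack (i : 'I_r) m : int :=
  (d * m ord_max)%N%:Z - (m (widen_ord (leqnSn r) i))%:Z.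

Lemma slackD i m1 m2 : slack i (m1 + m2)%MM = slack i m1 + slack i m2.
Proof. by rewrite /slack !mnmDE mulnDr !PoszD opprD addrACA. Qed.

Lemma slack0 i : slack i 0%MM = 0.
Proof. by rewrite /slack !mnm0E muln0. Qed.

Lemma slackX i m k : slack i (m *+ k)%MM = slack i m *+ k.
Proof. by elim: k => [|k IH]; rewrite ?mulm0n ?slack0 // mulmS slackD IH mulrS. Qed.

Lemma slack_rcons i v k : slack i (mnm_rcons v k) = (d * k)%N%:Z - (v i)%:Z.
Proof. by rewrite /slack mnm_rcons_max mnm_rcons_widen. Qed.

Variable R : idomainType.
Implicit Types (f g : {mpoly R[r.+1]}) (a b : 'I_r -> int).

Definition slack_ge a f : Prop :=
  forall m, m \in msupp f -> forall i, a i <= slack i m.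

Lemma slack_geD a f g : slack_ge a f -> slack_ge a g -> slack_ge a (f + g).
Proof. by move=> fa ga m /msuppD_le; rewrite mem_cat => /orP[/fa|/ga]. Qed.

Lemma slack_geM a b f g :
  slack_ge a f -> slack_ge b g -> slack_ge (fun i => a i + b i) (f * g).
Proof.
move=> fa gb m /msuppM_le/allpairsP[[m1 m2] /= [/fa fm /gb gm ->]] i.
by rewrite slackD lerD.
Qed.

Lemma slack_geX a m : slack_ge a 'X_[m] <-> forall i, a i <= slack i m.
Proof.
split=> [Xm i|am m']; first by apply: Xm; rewrite msuppX mem_seq1.
by rewrite msuppX mem_seq1 => /eqP->.
Qed.

Lemma slack_ge_trans a b f : (forall i, a i <= b i) -> slack_ge b f -> slack_ge a f.
Proof. by move=> ab fb m /fb bm i; apply: le_trans (ab i) (bm i). Qed.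

Lemma slack_geM_inv c f g : slack_ge c (f * g) ->
  forall m1 m2, m1 \in msupp f -> m2 \in msupp g ->
  forall i, c i <= slack i m1 + slack i m2.
Proof.
move=> fg m1 m2 f1 g2 i; apply: (weight_msuppM (slackD i)) f1 g2.
by move=> m /fg.
Qed.

End Box.

Section BoxToricRing.
Variables (K : fieldType) (r d : nat).
Local Notation P := (transversal_polymatroid (@box_family r d)).
Implicit Types (f g : {mpoly K[r.+1]}) (v : 'X_{1..r}) (m : 'X_{1..r.+1}).

Lemma toric_genE v : toric_gen K v = 'X_[mnm_rcons v 1].
Proof.
rewrite mpolyXE_id big_ord_recr /= mnm_rcons_max expr1; congr (_ * _).
by apply: eq_bigr => i _; rewrite mnm_rcons_widen.
Qed.

(** A lattice point at height [q] of the cone over the box is a sum of [q] lattice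
    points of the box: subtract [min(u_i, d)] in each coordinate and recurse. *)
Lemma monomial_toric m :
  (forall i, 0 <= slack d i m) -> 'X_[m] \in @toric_pred K r P.
Proof.
move: {-1}(m ord_max) (erefl (m ord_max)) => k.
elim: k m => [|k IH] m mk ge0_m.
  suff -> : m = 0%MM by rewrite mpolyX0 rpred1.
  apply/mnmP=> i; rewrite mnm0E; have [->//|[j ->]] := ord_max_or_widen i.
  by have := ge0_m j; rewrite /slack mk muln0; lia.
pose v := [multinom minn (m (widen_ord (leqnSn r) i)) d | i < r].
pose v' := [multinom (m (widen_ord (leqnSn r) i) - d)%N | i < r].
have -> : m = (mnm_rcons v 1 + mnm_rcons v' k)%MM.
  apply/mnmP=> i; rewrite mnmDE; have [->|[j ->]] := ord_max_or_widen i.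
    by rewrite !mnm_rcons_max mk.
  by rewrite !mnm_rcons_widen !mnmE; lia.
rewrite mpolyXD; apply: rpredM.
  rewrite -toric_genE; apply/asboolP/Subalgebra_gen; exists v => //.
  by rewrite box_polymatroid; apply/forallP=> i; rewrite mnmE geq_minr.
apply: IH => [|i]; first by rewrite mnm_rcons_max.
by have := ge0_m i; rewrite slack_rcons /slack mk mnmE; nia.
Qed.

Lemma toric_predP f : f \in @toric_pred K r P <-> slack_ge d (fun=> 0) f.
Proof.
split=> [/asboolP|ge0_f].
  elim=> {f} [_ [v Pv ->]|c|f g _ IHf _ IHg|f g _ IHf _ IHg].
  - rewrite toric_genE; apply/slack_geX => i; rewrite slack_rcons muln1.
    by move: Pv; rewrite box_polymatroid => /forallP/(_ i); lia.
  - move=> m; rewrite alg_mpolyC msuppC; case: ifP => // _.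
    by rewrite mem_seq1 => /eqP-> i; rewrite slack0.
  - exact: slack_geD.
  - by have := slack_geM IHf IHg; apply: slack_ge_trans.
rewrite [f]mpolyE big_seq; apply: rpred_sum => m f_m.
rewrite -mul_mpolyC rpredM //.
  by apply/asboolP; rewrite -alg_mpolyC; apply: Subalgebra_const.
by apply: monomial_toric => i; apply: ge0_f.
Qed.

End BoxToricRing.

(** * Polynomials as elements of the field of fractions of the toric ring *)

Lemma fracP (R : idomainType) (z : {fraction R}) :
  exists a b : R, b != 0 /\ z = FracField.tofrac a / FracField.tofrac b.
Proof.
rewrite -[z]reprK; case: (repr z) => [[a b] nz_b]; exists a, b; split=> //.
apply: canRL (mulfK _) _; first by rewrite tofrac_eq0.
unlock FracField.tofrac; rewrite -[LHS]FracField.pi_mul; apply/eqmodP => /=.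
by rewrite FracField.equivfE /FracField.mulf !numden_Ratio
  ?mulf_neq0 ?oner_neq0 ?mulr1 //= mulrC.
Qed.

Section Laurent.
Variables (K : fieldType) (r d : nat).
Hypothesis d_gt0 : (0 < d)%N.
Local Notation P := (transversal_polymatroid (@box_family r d)).
Local Notation B := {mpoly K[r.+1]}.
Local Notation R := (toric_ring K P).
Local Notation F := {fraction R}.
Local Notation "x %:F" := (@FracField.tofrac _ x).
Local Notation t := ('X_ord_max : B).
Implicit Types (f g : B) (m : 'X_{1..r.+1}) (a b : 'I_r -> int).

Lemma slack_t (i : 'I_r) : slack d i U_(ord_max)%MM = d%:Z.
Proof.
rewrite /slack !mnm1E eqxx muln1; case: eqP => [/(congr1 val)/= ri|_].
  by have := ltn_ord i; rewrite -ri ltnn.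
by rewrite subr0.
Qed.

Lemma slack_ge_tX N : slack_ge d (fun=> (d * N)%N%:Z) (t ^+ N).
Proof.
rewrite mpolyXn; apply/slack_geX => i.
by rewrite slackX slack_t -mulr_natr natz PoszM.
Qed.

Lemma slack_ge_msize f : slack_ge d (fun=> - (msize f)%:Z) f.
Proof.
move=> m f_m i; have := msize_mdeg_lt f_m.
have : (m (widen_ord (leqnSn r) i) <= mdeg m)%N.
  by rewrite mdegE (bigD1 (widen_ord (leqnSn r) i)) //= leq_addr.
rewrite /slack; move: (msize f) (mdeg m) (m _) (d * _)%N => x y z u; lia.
Qed.

(** Multiplying by [t] raises every slack by [d], which is positive, so every
    polynomial is a quotient of an element of the toric ring by a power of [t]. *)
Lemma clear_t f : t ^+ msize f * f \in @toric_pred K r P.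
Proof.
apply/toric_predP; have := slack_geM (@slack_ge_tX (msize f)) (@slack_ge_msize f).
by apply: slack_ge_trans => i; move: (msize f) => x; nia.
Qed.

Definition numer f : R := ToricRing (clear_t f).

Lemma t_toric : t \in @toric_pred K r P.
Proof.
by apply/toric_predP/slack_geX => i; rewrite slack_t.
Qed.

Definition toric_t : R := ToricRing t_toric.

Lemma toric_t_neq0 : toric_t != 0.
Proof.
by rewrite -(inj_eq val_inj) rmorph0 /= -msize_poly_eq0 msizeX.
Qed.

Definition laurent f : F := (numer f)%:F / toric_t%:F ^+ msize f.

(** Any other power of [t] that clears the denominator gives the same fraction;
    this freedom makes [laurent] a ring morphism. *)
Lemma laurentE f N (x : R) : val x = t ^+ N * f -> laurent f = x%:F / toric_t%:F ^+ N.
Proof.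
move=> xE; apply/eqP; rewrite eqr_div ?expf_neq0 ?tofrac_eq0 ?toric_t_neq0 //.
rewrite -!tofracXn -!tofracM tofrac_eq; apply/eqP/val_inj.
by rewrite !rmorphM !rmorphXn /= xE mulrAC [in RHS]mulrC [in RHS]mulrA.
Qed.

Lemma laurent_val (x : R) : laurent (val x) = x%:F.
Proof. by rewrite (@laurentE _ 0 x) ?expr0 ?mul1r ?divr1. Qed.

Fact laurent_is_zmod_morphism : zmod_morphism laurent.
Proof.
move=> f g.
rewrite (@laurentE (f - g) (msize f + msize g)
  (toric_t ^+ msize g * numer f - toric_t ^+ msize f * numer g)); last first.
  rewrite rmorphB !rmorphM !rmorphXn /= exprD mulrBr.
  by rewrite mulrA mulrA [X in X * f - _]mulrC.
have nz_t : toric_t%:F != 0 by rewrite tofrac_eq0 toric_t_neq0.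
rewrite tofracB !tofracM !tofracXn exprD mulrBl; congr (_ - _).
  rewrite [X in _ / X]mulrC -mulf_div divff ?mul1r ?expf_neq0 //.
by rewrite -mulf_div divff ?mul1r ?expf_neq0.
Qed.

Fact laurent_is_monoid_morphism : monoid_morphism laurent.
Proof.
split=> [|f g].
  by rewrite (@laurentE 1 0 1) ?expr0 ?divr1 ?rmorph1 ?mul1r.
rewrite (@laurentE _ (msize f + msize g) (numer f * numer g)).
  by rewrite /laurent rmorphM exprD -mulf_div.
by rewrite rmorphM /= exprD mulrACA.
Qed.

HB.instance Definition _ := GRing.isZmodMorphism.Build B F laurent laurent_is_zmod_morphism.
HB.instance Definition _ :=
  GRing.isMonoidMorphism.Build B F laurent laurent_is_monoid_morphism.

Lemma laurent_inj : injective laurent.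
Proof.
apply: raddf_inj => f /eqP; rewrite /laurent mulf_eq0 invr_eq0 expf_eq0 !tofrac_eq0.
rewrite (negbTE toric_t_neq0) andbF orbF => /eqP/(congr1 val).
rewrite rmorph0 /= => /eqP; rewrite mulf_eq0 expf_eq0 => /orP[/andP[_]|/eqP//].
by rewrite -msize_poly_eq0 msizeX.
Qed.

Lemma in_base_laurent f : in_base (laurent f) <-> slack_ge d (fun=> 0) f.
Proof.
split=> [[x]|/toric_predP Rf].
  rewrite -laurent_val => /laurent_inj ->; apply/toric_predP; exact: valP.
by exists (ToricRing Rf); rewrite -laurent_val.
Qed.

Lemma laurent_frac (z : F) : exists f g, g != 0 /\ z = laurent f / laurent g.
Proof.
have [x [y [nz_y ->]]] := fracP z; exists (val x), (val y); rewrite !laurent_val.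
by split=> //; rewrite -(inj_eq val_inj) rmorph0 in nz_y.
Qed.

End Laurent.

(** * Divisorial ideals of the toric ring *)

Lemma int_has_minimum (Q : int -> Prop) (c : int) :
  (exists x, Q x) -> (forall x, Q x -> c <= x) ->
  exists2 x, Q x & forall y, Q y -> x <= y.
Proof.
move=> [x0 Qx0] Q_ge.
have exn : exists n, `[< Q (c + n%:Z) >].
  exists `|x0 - c|%N; apply/asboolP; have := Q_ge _ Qx0.
  by rewrite -subr_ge0 => /gez0_abs->; rewrite addrC subrK.
case: (ex_minnP exn) => n /asboolP Qn minn; exists (c + n%:Z) => // y Qy.
have := Q_ge _ Qy; rewrite -subr_ge0 => /gez0_abs ynE.
have /minn : `[< Q (c + `|y - c|%N%:Z) >] by apply/asboolP; rewrite ynE addrC subrK.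
by lia.
Qed.

Section SlackIdeals.
Variables (K : fieldType) (r d : nat).
Hypothesis d_gt0 : (0 < d)%N.
Local Notation P := (transversal_polymatroid (@box_family r d)).
Local Notation B := {mpoly K[r.+1]}.
Local Notation R := (toric_ring K P).
Local Notation F := {fraction R}.
Local Notation "x %:F" := (@FracField.tofrac _ x).
Local Notation t := ('X_ord_max : B).
Local Notation phi := (@laurent K r d d_gt0).
Implicit Types (f g : B) (m : 'X_{1..r.+1}) (a b : 'I_r -> int) (z y : F).

Lemma laurent_eq0 f : (phi f == 0) = (f == 0).
Proof. by rewrite -(rmorph0 phi) (inj_eq (@laurent_inj _ _ _ d_gt0)). Qed.

Lemma laurent_t_neq0 N : phi (t ^+ N) != 0.
Proof. by rewrite laurent_eq0 expf_neq0 // -msize_poly_eq0 msizeX. Qed.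

(** The Laurent polynomials in [t] that are polynomials in the [x_i] and whose
    monomials have slacks at least [a]: they are the sections of the Weil divisor
    with coefficient [- a i] along the [i]-th slack facet.  Entries of [a] may be
    negative, so that duality is negation; the power of [t] in the denominator
    makes room for that. *)
Definition slack_ideal a : set F := fun z =>
  exists N f, slack_ge d (fun i => a i + (d * N)%N%:Z) f /\ z = phi f / phi (t ^+ N).

Lemma eq_slack_ideal a b : a =1 b -> slack_ideal a = slack_ideal b.
Proof. by move/funext->. Qed.

Lemma slack_ideal_laurent a f : slack_ge d a f -> slack_ideal a (phi f).
Proof.
move=> fa; exists 0, f; rewrite expr0 rmorph1 divr1; split=> //.
by apply: slack_ge_trans fa => i; rewrite muln0 addr0.
Qed.

Lemma slack_idealM a b y z :
  slack_ideal a y -> slack_ideal b z -> slack_ideal (fun i => a i + b i) (y * z).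
Proof.
move=> [N [f [fa ->]]] [M [g [gb ->]]]; exists (N + M)%N, (f * g).
rewrite mulf_div exprD !(rmorphM phi); split=> //.
by apply: slack_ge_trans (slack_geM fa gb) => i /=; rewrite mulnDr PoszD addrACA.
Qed.

(** The divisor of [t] is [d] times the sum of the slack facets. *)
Lemma scale_slack_ideal a k :
  scale_ideal (phi (t ^+ k)) (slack_ideal a) = slack_ideal (fun i => a i + (d * k)%N%:Z).
Proof.
apply: funext => z; apply: propext; split=> [[y ay ->]|[N [f [fa ->]]]].
  rewrite mulrC; apply: slack_idealM => //.
  exact/slack_ideal_laurent/slack_ge_tX.
exists (phi f / phi (t ^+ (N + k))).
  exists (N + k)%N, f; split=> //; apply: slack_ge_trans fa => i.
  by rewrite mulnDr PoszD [_%:Z + _]addrC addrA.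
rewrite exprD (rmorphM phi) /=; move: (phi f) (phi (t ^+ N)) => x y.
by rewrite [RHS]mulrC invfM -!mulrA mulVf ?mulr1 ?laurent_t_neq0.
Qed.

(* The monomial of t-degree N with slacks a, available once a <= d N *)
(** The monomial with [t]-exponent [N] and with slacks exactly [a], which exists as
    soon as [a <= d * N]. *)
Definition tight a N : 'X_{1..r.+1} :=
  mnm_rcons [multinom `|(d * N)%N%:Z - a i|%N | i < r] N.

Lemma slack_tight a N i : a i <= (d * N)%N%:Z -> slack d i (tight a N) = a i.
Proof. by move=> le_a; rewrite slack_rcons mnmE; lia. Qed.

Lemma tight_bound a b : exists N, forall i, a i <= (d * N)%N%:Z /\ b i <= (d * N)%N%:Z.
Proof.
exists (\sum_i (`|a i| + `|b i|))%N => i; rewrite (bigD1 i) //=.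
by move: (\sum_(_ | _) _)%N => x; nia.
Qed.

(** Two monomials of [slack_ideal a] suffice to bound its dual: the power of [t]
    excludes denominators other than powers of [t], and the tight monomial gives
    all the slack conditions at once. *)
Lemma dual_slack_sub a N z : (forall i, a i <= (d * N)%N%:Z) ->
  in_base (z * phi (t ^+ N)) -> in_base (z * phi 'X_[tight a N]) ->
  slack_ideal (fun i => - a i) z.
Proof.
move=> le_a [x zN] [y zX].
have zE : z = phi (val x) / phi (t ^+ N).
  by rewrite laurent_val -zN mulfK ?laurent_t_neq0.
have eq_p : val x * 'X_[tight a N] = t ^+ N * val y.
  apply: (@laurent_inj _ _ _ d_gt0); rewrite !(rmorphM phi) /= !laurent_val -zX -zN.
  by rewrite -mulrA mulrCA.
exists N, (val x); split=> // m x_m i.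
have /toric_predP Ry := valP y.
have tX : tight a N \in msupp ('X_[tight a N] : B) by rewrite msuppX mem_seq1.
have := slack_geM (@slack_ge_tX K r d N) Ry; rewrite -eq_p.
by move=> /slack_geM_inv/(_ _ _ x_m tX i); rewrite slack_tight //; lia.
Qed.

Hypothesis r_gt0 : (0 < r)%N.

(** A nonnegative slack makes the exponent of [t] nonnegative; this is where at
    least one slack is needed. *)
Lemma slack_ideal0 : slack_ideal (fun=> 0) = @in_base R.
Proof.
apply: funext => z; apply: propext; split=> [[N [f [fN ->]]]|[x ->]]; last first.
  rewrite -(laurent_val d_gt0); apply: slack_ideal_laurent; apply/toric_predP; exact: valP.
have [g fE] : dvdr (t ^+ N) f.
  rewrite [f]mpolyE big_seq; apply: dvdr_sum => m /fN/(_ (Ordinal r_gt0)) slack_m.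
  rewrite mpolyXn; exists (f@_m *: 'X_[m - U_(ord_max) *+ N]).
  rewrite -scalerAr -mpolyXD addmC submK //.
  apply/mnm_lepP=> i; rewrite mulmnE mnm1E; case: eqP => // <-.
  by move: slack_m; rewrite /slack mul1n add0r; nia.
rewrite fE rmorphM mulrC mulKf ?laurent_t_neq0 //; apply/in_base_laurent => m g_m i.
have tN : (U_(ord_max) *+ N)%MM \in msupp (t ^+ N) by rewrite mpolyXn msuppX mem_seq1.
rewrite fE in fN; have := slack_geM_inv fN tN g_m i.
by rewrite slackX slack_t -mulr_natr natz PoszM; lia.
Qed.

Lemma dual_slack_ideal a : dual (slack_ideal a) = slack_ideal (fun i => - a i).
Proof.
apply: funext => z; apply: propext; split=> [dz|az y ay]; last first.
  rewrite -slack_ideal0; have := slack_idealM az ay.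
  by congr (slack_ideal _ _); apply: funext => i; rewrite addNr.
have [N le_a] := tight_bound a a; apply: (@dual_slack_sub a N) => [i||].
- by have [? ?] := le_a i.
- apply: dz; apply: slack_ideal_laurent; apply: slack_ge_trans (@slack_ge_tX _ _ _ N) => i.
  by have [? ?] := le_a i.
- apply: dz; apply: slack_ideal_laurent; apply/slack_geX => i.
  by rewrite slack_tight //; have [? ?] := le_a i.
Qed.

Lemma vclosure_slack_ideal a : vclosure (slack_ideal a) = slack_ideal a.
Proof.
by rewrite /vclosure !dual_slack_ideal; apply: eq_slack_ideal => i; rewrite opprK.
Qed.

(** The two monomials to which [dual_slack_sub] applies can be chosen to be
    products of a monomial of each ideal. *)
Lemma vclosure_slack_ideal_mul a b :
  vclosure (mul_ideal (slack_ideal a) (slack_ideal b)) =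
  slack_ideal (fun i => a i + b i).
Proof.
rewrite /vclosure (_ : dual (mul_ideal _ _) = slack_ideal (fun i => - (a i + b i))).
  by rewrite dual_slack_ideal; apply: eq_slack_ideal => i; rewrite opprK.
apply: funext => z; apply: propext; rewrite dual_mulP; split=> [dz|abz x y ax bzy]; last first.
  rewrite -slack_ideal0; have := slack_idealM abz (slack_idealM ax bzy).
  by congr (slack_ideal _ _); apply: funext => i; rewrite addNr.
have [N le_ab] := tight_bound a b.
apply: (@dual_slack_sub _ (N + N)%N) => [i||].
- by have [? ?] := le_ab i; rewrite mulnDr PoszD; apply: lerD.
- rewrite exprD rmorphM; apply: dz; apply: slack_ideal_laurent;
    apply: slack_ge_trans (@slack_ge_tX _ _ _ N) => i; by have [? ?] := le_ab i.
- rewrite (_ : tight _ _ = tight a N + tight b N)%MM ?mpolyXD ?rmorphM.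
    apply: dz; apply: slack_ideal_laurent; apply/slack_geX => i;
    by rewrite slack_tight //; have [] := le_ab i.
  apply/mnmP=> i; rewrite mnmDE; have [->|[j ->]] := ord_max_or_widen i.
    by rewrite !mnm_rcons_max.
  by rewrite !mnm_rcons_widen !mnmE; have [? ?] := le_ab j; lia.
Qed.

Lemma divisorial_slack_ideal a : divisorial (slack_ideal a).
Proof.
have [N le_a] := tight_bound a (fun i => - a i).
have tN b : (forall i, b i <= (d * N)%N%:Z) -> slack_ideal b (phi (t ^+ N)).
  by move=> le_b; apply: slack_ideal_laurent; apply: slack_ge_trans (@slack_ge_tX _ _ _ N).
rewrite -vclosure_slack_ideal.
have tR : t ^+ N \in @toric_pred K r P by rewrite rpredX // t_toric.
apply: (@divisorial_vclosure _ _ (ToricRing tR)).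
- exists (phi (t ^+ N)); last exact: laurent_t_neq0.
  by apply: tN => i; have [? ?] := le_a i.
- by rewrite -(tofrac_eq0 (ToricRing tR)) -(laurent_val d_gt0) laurent_t_neq0.
move=> x; rewrite -(laurent_val d_gt0) /=.
have : dual (slack_ideal a) (phi (t ^+ N)).
  by rewrite dual_slack_ideal; apply: tN => i; have [? ?] := le_a i.
by apply.
Qed.

Lemma slack_ideal_quotient c a b :
  (forall y, slack_ideal a y -> slack_ideal b (c * y)) ->
  slack_ideal (fun i => b i - a i) c.
Proof.
move=> cab; have: dual (mul_ideal (slack_ideal a) (slack_ideal (fun i => - b i))) c.
  rewrite dual_mulP => y z ay bz; rewrite mulrA -slack_ideal0.
  have := slack_idealM (cab y ay) bz.
  by congr (slack_ideal _ _); apply: funext => i; rewrite subrr.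
rewrite -dual_vclosure vclosure_slack_ideal_mul dual_slack_ideal.
by congr (slack_ideal _ _); apply: funext => i; rewrite opprD opprK addrC.
Qed.

(** Both [c] and its inverse are Laurent polynomials, with slacks at least [b - a]
    and [a - b].  Their numerators multiply to a power of [t], hence are themselves
    monomials in [t] alone, and the slacks of a power of [t] are all the same
    multiple of [d]. *)
Lemma scale_slack_ideal_inj c a b :
  c != 0 -> slack_ideal b = scale_ideal c (slack_ideal a) ->
  exists k : int, forall i, b i = a i + d%:Z * k.
Proof.
move=> nz_c bca.
have [|N [f [f_ge cE]]] := @slack_ideal_quotient c a b.
  by move=> y ay; rewrite bca; exists y.
have [|M [g [g_ge cVE]]] := @slack_ideal_quotient c^-1 b a.
  by move=> y; rewrite bca => -[z az ->]; rewrite mulKf.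
have fg : f * g = t ^+ (N + M).
  apply: (@laurent_inj _ _ _ d_gt0); rewrite exprD !(rmorphM phi).
  apply: (mulIf (invr_neq0 (laurent_t_neq0 (N + M)))).
  rewrite exprD !(rmorphM phi) invfM mulrACA -cE -cVE divff //.
  by rewrite mulrACA !divff ?mulr1 ?laurent_t_neq0.
have /andP[nz_f nz_g] : (f != 0) && (g != 0).
  by rewrite -negb_or -mulf_eq0 fg -laurent_eq0 laurent_t_neq0.
have f_m := mlead_supp nz_f; have g_m := mlead_supp nz_g.
set m1 := mlead f in f_m; set m2 := mlead g in g_m.
exists ((m1 ord_max)%:Z - N%:Z) => i.
have := f_ge _ f_m i; have := g_ge _ g_m i; rewrite /slack.
have weight (l : 'X_{1..r.+1} -> int) :
    (forall m m', l (m + m')%MM = l m + l m') ->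
    l (U_(ord_max) *+ (N + M))%MM <= l m1 + l m2.
  move=> lD; apply: (weight_msuppM lD) f_m g_m => m.
  by rewrite fg mpolyXn msuppX mem_seq1 => /eqP->.
have lD j (m m' : 'X_{1..r.+1}) : - ((m + m')%MM j)%:Z = - (m j)%:Z + - (m' j)%:Z.
  by rewrite mnmDE PoszD opprD.
have := weight _ (lD (widen_ord (leqnSn r) i)); have := weight _ (lD ord_max).
rewrite !mulmnE !mnm1E eqxx.
have /negPf-> : ord_max != widen_ord (leqnSn r) i.
  by apply/eqP=> /(congr1 val)/= ri; have := ltn_ord i; rewrite -ri ltnn.
rewrite mul0n mul1n.
nia.
Qed.

(** Divide [I] by the gcd [h] of its elements, taken in the polynomial ring.  An
    element of the dual of the quotient then has no denominator in the polynomial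
    ring, so that only the valuations along the slack facets matter, and these
    are bounded by the least slacks [a] occurring in the quotient. *)
Lemma divisorial_slack (I : set F) : divisorial I ->
  exists a c, c != 0 /\ I = scale_ideal c (slack_ideal a).
Proof.
case=> [[_ _ _ [b nz_b bI]] [x0 Ix0 nz_x0] vI].
(* I0 is b I seen as a set of polynomials, and I1 is its quotient by h *)
pose I0 f := I (phi f / b%:F).
have nz_bF : b%:F != 0 by rewrite tofrac_eq0.
have I_I0 x : I x -> exists2 f, I0 f & x = phi f / b%:F.
  move=> Ix; have [y xy] := bI x Ix; have xE : x = y%:F / b%:F by rewrite -xy mulrC mulKf.
  by exists (val y); rewrite /I0 laurent_val -xE.
have I0R f : I0 f -> slack_ge d (fun=> 0) f.
  by move=> /bI; rewrite mulrC divfK // => /in_base_laurent.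
have [|h [nz_h hI0 gcd_h]] := @mpoly_gcd_family K _ I0.
  have [f I0f x0E] := I_I0 _ Ix0; exists f => //.
  by apply: contraNneq nz_x0 => f0; rewrite x0E f0 raddf0 mul0r.
pose c := phi h / b%:F; have nz_c : c != 0 by rewrite mulf_neq0 ?invr_eq0 ?laurent_eq0.
pose I1 f := I (c * phi f).
have I1_ex : exists2 f, I1 f & f != 0.
  have [f I0f x0E] := I_I0 _ Ix0; have [k fE] := hI0 f I0f; exists k.
    by rewrite /I1 /c mulrAC -(rmorphM phi) -fE.
  apply: contraNneq nz_x0 => k0.
  by rewrite x0E fE k0 mulr0 raddf0 mul0r.
have I1_slack i : exists x,
    (exists f m, [/\ I1 f, m \in msupp f & slack d i m = x]) /\
    (forall f m, I1 f -> m \in msupp f -> x <= slack d i m).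
  have h_m := mlead_supp nz_h.
  have [||x Qx minx] := @int_has_minimum
     (fun x => exists f m, [/\ I1 f, m \in msupp f & slack d i m = x])
     (- slack d i (mlead h)).
  - have [f I1f nz_f] := I1_ex; exists (slack d i (mlead f)), f, (mlead f).
    by split=> //; apply: mlead_supp.
  - move=> _ [f [m [I1f f_m <-]]].
    have : I0 (h * f) by rewrite /I0 (rmorphM phi) mulrAC.
    by move=> /I0R/slack_geM_inv/(_ _ _ h_m f_m i); lia.
  by exists x; split=> // f m I1f f_m; apply: minx; exists f, m.
have [a aP] := choice I1_slack.
exists a, c; split=> //.
have I_cI1 x : I x -> exists2 f, I1 f & x = c * phi f.
  move=> /I_I0[f I0f ->]; have [k fE] := hI0 f I0f; exists k.
    by rewrite /I1 /c mulrAC -(rmorphM phi) -fE.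
  by rewrite /c [RHS]mulrAC -(rmorphM phi) -fE.
suff dualI : dual I = scale_ideal c^-1 (slack_ideal (fun i => - a i)).
  rewrite -vI /vclosure dualI dual_scale ?invr_eq0 // invrK dual_slack_ideal.
  by congr scale_ideal; apply: eq_slack_ideal => i; rewrite opprK.
apply: funext => z; apply: propext; split=> [dz|[y ay ->] x /I_cI1[f I1f ->]]; last first.
  rewrite mulrACA mulVf // mul1r -slack_ideal0.
  have fa : slack_ge d a f by move=> m f_m i; have [_ a_min] := aP i; apply: a_min I1f f_m.
  have := slack_idealM ay (slack_ideal_laurent fa).
  by congr (slack_ideal _ _); apply: funext => i; rewrite addNr.
exists (c * z); last by rewrite mulKf.
have [p [q [nz_q czE]]] := laurent_frac d_gt0 (c * z).
have czR f : I1 f -> in_base (c * z * phi f).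
  by move=> I1f; rewrite mulrAC mulrC; apply: dz.
have [p' pE] : dvdr q p.
  apply: (@dvdr_mul2l _ h) => //; rewrite [h * p]mulrC; apply: gcd_h => f I0f.
  have [k fE] := hI0 f I0f.
  have [|y] := czR k; first by rewrite /I1 /c mulrAC -(rmorphM phi) -fE.
  rewrite czE -(laurent_val d_gt0) mulrAC => /(canRL (divfK _)).
  rewrite laurent_eq0 => /(_ nz_q); rewrite -!(rmorphM phi) => /laurent_inj pk.
  by exists (val y); rewrite fE mulrCA pk [val y * q]mulrC mulrA.
have {}czE : c * z = phi p'.
  by rewrite czE pE (rmorphM phi) /= mulrC mulKf ?laurent_eq0.
rewrite czE; apply: slack_ideal_laurent => m p_m i.
have [[f [m' [I1f f_m' <-]]] _] := aP i.
have := czR f I1f; rewrite czE -(rmorphM phi) => /in_base_laurent.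
by move=> /slack_geM_inv/(_ _ _ p_m f_m' i); lia.
Qed.

End SlackIdeals.

(** * The class group *)

Section SlackClasses.
Variables (n p : nat).
Implicit Types a b : 'I_n.+1 -> int.

Lemma Zp1_mulz_eq0 (z : int) :
  Zp1 *~ z = 0 :> 'I_p.+1 <-> exists k : int, z = p.+1%:Z * k.
Proof.
have Zp1_mulrn (k : nat) : Zp1 *+ k = inZp k :> 'I_p.+1.
  by rewrite Zp_mulrn; apply: val_inj; rewrite /= modnMml mul1n.
have Zp1_mulrn0 : Zp1 *+ p.+1 = 0 :> 'I_p.+1.
  by rewrite Zp1_mulrn; apply: val_inj; rewrite /= modnn.
split=> [z0|[k ->]]; last by rewrite mulrzA -pmulrn Zp1_mulrn0 mul0rz.
have : (p.+1 %| `|z|)%N.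
  have : Zp1 *+ `|z|%N = 0 :> 'I_p.+1.
    rewrite pmulrn abszEsign mulrC mulrzA z0; exact: mul0rz.
  by rewrite Zp1_mulrn => /(congr1 val)/= /eqP.
case/dvdnP=> k zE; exists (sgz z * k%:Z).
by rewrite {1}[z]intEsg zE PoszM mulrA mulrC.
Qed.

(** The isomorphism of [Z^(n+1) / Z (p+1, ..., p+1)] with [Z^n + Z/(p+1)]: the
    differences with the first entry are free, and only the residue of the first
    entry survives. *)
Definition slack_coords a : 'rV[int]_n * 'I_p.+1 :=
  (\row_j (a (lift ord0 j) - a ord0), Zp1 *~ a ord0).

Lemma slack_coordsP a b :
  slack_coords a = slack_coords b <->
  exists k : int, forall i, b i = a i + p.+1%:Z * k.
Proof.
split=> [[/rowP ab ab0]|[k abk]].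
  have /Zp1_mulz_eq0[k kE] : Zp1 *~ (b ord0 - a ord0) = 0 :> 'I_p.+1.
    by rewrite mulrzBr ab0 subrr.
  exists k => i; have [j|] := unliftP ord0 i; last by move->; lia.
  by move->; have := ab j; rewrite !mxE; lia.
congr (_, _).
  by apply/rowP=> j; rewrite !mxE !abk; lia.
rewrite abk mulrzDr; have /Zp1_mulz_eq0 -> : exists k' : int, p.+1%:Z * k = p.+1%:Z * k'.
  by exists k.
by rewrite addr0.
Qed.

Lemma slack_coordsD a b :
  slack_coords (fun i => a i + b i) = slack_coords a + slack_coords b.
Proof.
congr (_, _); last by rewrite /= mulrzDr.
by apply/rowP=> j; rewrite !mxE; lia.
Qed.

Lemma slack_coords0 : slack_coords (fun=> 0) = 0.
Proof.
by congr (_, _); apply/rowP=> j; rewrite !mxE subrr.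
Qed.

Lemma slack_coords_surj x : exists a, slack_coords a = x.
Proof.
case: x => u v.
exists (fun i => (if unlift ord0 i is Some j then u 0 j else 0) + (v : nat)%:Z).
rewrite /slack_coords; congr (_, _).
  apply/rowP=> j; rewrite !mxE liftK; case: unliftP => [k /(congr1 val)//|_]; lia.
case: unliftP => [k /(congr1 val)//|_]; rewrite add0r -pmulrn Zp_mulrn.
by apply: val_inj; rewrite /= modnMml mul1n modn_small.
Qed.

End SlackClasses.

Section ClassGroup.
Variables (K : fieldType) (n p : nat).
Local Notation r := n.+1.
Local Notation d := p.+1.
Local Notation P := (transversal_polymatroid (@box_family r d)).
Local Notation R := (toric_ring K P).
Implicit Types a b : 'I_r -> int.

Let r_gt0 : (0 < r)%N. Proof. by []. Qed.
Let d_gt0 : (0 < d)%N. Proof. by []. Qed.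
Local Notation J := (slack_ideal K d_gt0).

Definition slack_class a : Cl R :=
  \pi_(Cl R) (DivisorialIdeal (divisorial_slack_ideal K d_gt0 r_gt0 a)).

Lemma slack_classP a b :
  slack_class a = slack_class b <-> slack_coords p a = slack_coords p b.
Proof.
rewrite slack_coordsP; split=> [/(@eqquotP _ _ (Cl R))/asboolP[c nz_c /= bca]|].
  exact: (scale_slack_ideal_inj r_gt0 nz_c bca).
suff scale a' b' (k : nat) :
    (forall i, b' i = a' i + d%:Z * k%:Z) -> slack_class a' = slack_class b'.
  case=> -[k|k] abk; first exact: (scale _ _ k).
  by apply/esym/(scale _ _ k.+1) => i; rewrite abk; lia.
move=> abk; apply/(@eqquotP _ _ (Cl R))/asboolP.
exists (laurent d_gt0 ('X_ord_max ^+ k)); first exact: laurent_t_neq0.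
by rewrite /= scale_slack_ideal; apply: eq_slack_ideal => i; rewrite abk PoszM.
Qed.

Lemma slack_classD a b : slack_class (fun i => a i + b i) = slack_class a + slack_class b.
Proof.
rewrite -[RHS]pi_mul_div; congr (\pi_(Cl R) _); apply: divisorial_ideal_inj.
by rewrite /= vclosure_slack_ideal_mul.
Qed.

Lemma slack_class0 : slack_class (fun=> 0) = 0.
Proof.
congr (\pi_(Cl R) _); apply: divisorial_ideal_inj.
exact: slack_ideal0.
Qed.

Lemma slack_class_surj (X : Cl R) : exists a, slack_class a = X.
Proof.
rewrite -[X]reprK; case: (repr X) => I /= divI.
have [a [c [nz_c IE]]] := divisorial_slack d_gt0 r_gt0 divI.
by exists a; apply/(@eqquotP _ _ (Cl R))/asboolP; exists c.
Qed.

Lemma Cl_box_iso :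
  exists f : {additive Cl R -> 'rV[int]_n * 'I_p.+1}, bijective f.
Proof.
have [s sP] := choice slack_class_surj.
have [c cP] := choice (@slack_coords_surj n p).
pose f X := slack_coords p (s X).
have f_class a : f (slack_class a) = slack_coords p a.
  by apply/slack_classP; rewrite sP.
have fD : nmod_morphism f.
  split=> [|X Y]; first by rewrite -slack_class0 f_class slack_coords0.
  by rewrite -{1}[X]sP -{1}[Y]sP -slack_classD f_class slack_coordsD.
pose f_morph := GRing.isNmodMorphism.Build _ _ f fD.
pose F : {additive Cl R -> 'rV[int]_n * 'I_p.+1} := HB.pack f f_morph.
exists F; exists (fun x => slack_class (c x)) => [X|x] /=.
  by rewrite -[RHS]sP; apply/slack_classP; rewrite cP.
by rewrite f_class cP.
Qed.

End ClassGroup.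

Theorem corollary4p7 (K : fieldType) (r d : nat) (hr : (0 < r)%N) (hd : (0 < d)%N) :
  exists (n s : nat) (A : 'I_s -> {set 'I_n}),
    presentation A /\
    exists f : {additive Cl (toric_ring K (transversal_polymatroid A)) ->
                         'rV[int]_(r - 1) * 'I_(d.-1.+1)},
      bijective f.
Proof.
exists r, _, (@box_family r d); split; first exact: box_presentation.
case: r hr => // n _; case: d hd => // p _; rewrite subn1.
exact: Cl_box_iso.
Qed.
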